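(* Let $\mu_1,\mu_2\in\mathbb{R}$, $\sigma_1,\sigma_2>0$ and $k>0$. Consider two stocks with positive prices $p_{it}$, $i=1,2$, at discrete times $t=0,1,2,\dots$, with deterministic equal initial log-prices $\log p_{10}=\log p_{20}$ and $$\log(p_{i,t+1})=\log(p_{it})+\mu_i+\delta_{i,t+1},$$ where all the $\delta_{it}$ ($i=1,2$, $t\ge1$) are independent and $\delta_{it}\sim N(0,\sigma_i^2)$. Define the spread $\epsilon_t=\log(p_{2t})-\log(p_{1t})-(\mu_2-\mu_1)t$ (so $\epsilon_t\sim N(0,s_t^2)$ with $s_t^2=t(\sigma_1^2+\sigma_2^2)$), the signal $S_t=\mathbb{1}\{\epsilon_t\le -ks_t\}-\mathbb{1}\{\epsilon_t\ge ks_t\}$, stock returns $r_{i,t+1}=p_{i,t+1}/p_{it}-1$, and pair return $r_{t+1}=S_t(r_{2,t+1}-r_{1,t+1})$. Let $Z$ be a standard normal random variable. Then for every $t\ge1$, $$\mathbf{E}[r_{t+1}]=0,\qquad \operatorname{Var}(r_{t+1})=2\,\mathbf{P}(Z\ge k)\Big(e^{2\mu_1+2\sigma_1^2}+e^{2\mu_2+2\sigma_2^2}-2e^{\mu_1+\mu_2+\sigma_1^2/2+\sigma_2^2/2}\Big).$$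
   Context: This models a non-cointegrated pair: both log-prices follow independent Gaussian random walks with drift. *)

(* Defs.v *)
From HB Require Import structures.
From mathcomp Require Import all_boot all_order all_algebra.
From mathcomp Require Import all_classical all_reals all_analysis.
From mathcomp Require Import probability.
Set Implicit Arguments. Unset Strict Implicit. Unset Printing Implicit Defensive.
Import Order.TTheory GRing.Theory Num.Theory.
Local Open Scope classical_set_scope.
Local Open Scope ring_scope.

Definition mutually_independent d (T : measurableType d) (R : realType)
  (P : probability T R) (I : eqType) (X : I -> T -> R) : Prop :=
  forall (J : seq I) (B : I -> set R), uniq J -> (forall i, measurable (B i)) ->
    P (\bigcap_(j in [set` J]) (X j @^-1` B j)) =
    (\prod_(j <- J) P (X j @^-1` B j))%E.

(* X has the normal distribution N(m, s^2) (s is the standard deviation). *)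
Definition has_normal_law d (T : measurableType d) (R : realType)
  (P : probability T R) (X : {RV P >-> R}) (m s : R) : Prop :=
  forall A : set R, measurable A -> distribution P X A = normal_prob m s A.

(* Main.v *)
Require Import Defs.
From HB Require Import structures.
From mathcomp Require Import all_boot all_order all_algebra.
From mathcomp Require Import all_classical all_reals all_analysis.
From mathcomp Require Import probability measurable_realfun ring lra.
Import Order.TTheory GRing.Theory Num.Theory.
Local Open Scope classical_set_scope.
Local Open Scope ring_scope.

(** Up to time [t] the spread is a signed sum of the increments, hence Gaussian
    with variance [s_t ^ 2] and independent of the two increments at time
    [t + 1].  On each of the two disjoint trading events, which have the same
    probability [P (Z >= k)] by symmetry, the difference [D] of the two gross
    returns therefore has the same integral, and these cancel in the mean as
    the signal takes opposite signs; in the second moment they add up to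
    [2 P (Z >= k) E[D ^ 2]], and [D ^ 2] is a combination of exponentials of
    Gaussian variables. *)

(** Scaled by [a], the image of Lebesgue measure under [x |-> a * x + b] gives every interval []u,
    v]] its length, so by uniqueness it is Lebesgue measure. *)
Lemma ge0_integral_lebesgue_affine (R : realType) (a b : R) (f : R -> \bar R) :
  0 < a -> measurable_fun [set: R] f -> (forall x, 0 <= f x)%E ->
  (\int[lebesgue_measure]_x f x =
   a%:E * \int[lebesgue_measure]_x f (a * x + b)%R)%E.
Proof.
move=> a0 mf f0.
have mphi : measurable_fun [set: measurableTypeR R]
    ((fun x => a * x + b) : R -> measurableTypeR R).
  by apply: measurable_funD => //; exact: measurable_funM.
pose k : {nonneg R} := NngNum (ltW a0).
rewrite (eq_measure_integral (mscale k (pushforward lebesgue_measure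
  ((fun x => a * x + b) : R -> measurableTypeR R)))).
  by rewrite ge0_integral_mscale// ge0_integral_pushforward.
move=> A mA _; apply: lebesgue_measure_unique => // _ [[u v] _ <-].
rewrite /= /mscale /= /pushforward.
have -> : (fun x => a * x + b) @^-1` `]u, v] =
    `](u - b) / a, (v - b) / a]%classic.
  apply/seteqP; split=> x /=; rewrite !in_itv/= => /andP[h1 h2]; apply/andP.
    by rewrite ltr_pdivrMr// ler_pdivlMr//; split; lra.
  by move: h1 h2; rewrite ltr_pdivrMr// ler_pdivlMr// => h1 h2; split; lra.
rewrite !lebesgue_measure_itv/= !lte_fin ltr_pM2r ?invr_gt0// ltrD2r.
case: ifPn => _; last by rewrite mule0.
rewrite -!EFinD -EFinM; congr EFin; field.
by rewrite gt_eqF.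
Qed.

(** * Gaussian measures on the line: density, symmetry, scaling, exponential moments, convolution *)

Section normal.
Context {R : realType}.
Local Notation mu := (@lebesgue_measure R).
Implicit Types (m s a b c : R) (A : set R).

(** The Radon-Nikodym derivative of [normal_prob m s] and [normal_pdf m s] have the same integral
    over every measurable set, hence agree almost everywhere. *)
Lemma ge0_integral_normal_prob m s (f : R -> \bar R) :
  measurable_fun [set: R] f -> (forall x, 0 <= f x)%E ->
  (\int[normal_prob m s]_x f x = \int[mu]_x (f x * (normal_pdf m s x)%:E))%E.
Proof.
move=> mf f0.
have dom := normal_prob_dominates m s.
rewrite -(Radon_Nikodym_SigmaFinite.change_of_variables dom)//.
have mpdf : measurable_fun [set: R] (fun x => (normal_pdf m s x)%:E).
  by apply/measurable_EFinP; exact: measurable_normal_pdf.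
have iRN := Radon_Nikodym_SigmaFinite.f_integrable dom.
apply: ae_eq_integral => //.
- by apply: emeasurable_funM => //; exact: measurable_int iRN.
- exact: emeasurable_funM.
- apply: ae_eqe_mul2l; apply: integral_ae_eq => //.
  by move=> E _ mE; rewrite -Radon_Nikodym_SigmaFinite.f_integral.
Qed.

Lemma normal_probE m s A : measurable A ->
  (normal_prob m s A =
   \int[mu]_x ((\1_A x)%:E * (normal_pdf m s x)%:E))%E.
Proof.
move=> mA; rewrite -ge0_integral_normal_prob//.
  by rewrite integral_indic// setIT.
by apply/measurable_EFinP; exact: measurable_indic.
Qed.

(** The centred density is even and Lebesgue measure is invariant under reflection. *)
Lemma normal_prob_opp s A : s != 0 -> measurable A ->
  normal_prob 0 s (-%R @^-1` A) = normal_prob 0 s A.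
Proof.
move=> s0 mA; rewrite /normal_prob.
have mpdf : measurable_fun A (fun x => (normal_pdf 0 s x)%:E).
  by apply/measurable_EFinP/measurable_funTS; exact: measurable_normal_pdf.
rewrite [RHS](eq_measure_integral (pushforward mu
    (-%R : _ -> measurableTypeR R))); last first.
  by move=> B mB _; exact/esym/lebesgue_measureN.
transitivity (\int[mu]_(x in -%R @^-1` A)
    ((fun x : measurableTypeR R => (normal_pdf 0 s x)%:E) \o -%R) x)%E;
    last first.
  apply/esym/ge0_integral_pushforward => //.
  by move=> x _; rewrite lee_fin normal_pdf_ge0.
apply: eq_integral => x _ /=; congr EFin.
by rewrite !normal_pdfE// /normal_fun !subr0 sqrrN.
Qed.

Lemma normal_peakE s : 0 < s -> normal_peak s = s^-1 * (Num.sqrt (pi *+ 2))^-1.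
Proof.
move=> s0; rewrite /normal_peak -mulrnAr sqrtrM ?sqr_ge0// sqrtr_sqr.
by rewrite gtr0_norm// invfM.
Qed.

Lemma normal_pdf_scale s x : 0 < s ->
  s * normal_pdf 0 s (s * x) = normal_pdf 0 1 x.
Proof.
move=> s0; rewrite !normal_pdfE ?gt_eqF//= !normal_peakE//.
rewrite invr1 mul1r !mulrA divff ?gt_eqF// mul1r; congr (_ * expR _).
by field; rewrite gt_eqF.
Qed.

(** Substituting [s * x] for [x] standardises the variable; this turns the threshold [k * s_t] into
    [k]. *)
Lemma normal_prob_tail s k : 0 < s ->
  normal_prob 0 s `[k * s, +oo[ = normal_prob 0 1 `[k, +oo[.
Proof.
move=> s0; rewrite !(normal_probE _ _ _ (measurable_itv _)).
rewrite (@ge0_integral_lebesgue_affine _ s 0)//; last 2 first.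
- apply: emeasurable_funM; apply/measurable_EFinP => //.
  exact: measurable_normal_pdf.
- by move=> x; rewrite mule_ge0// lee_fin ?normal_pdf_ge0.
rewrite -ge0_integralZl//; last 3 first.
- apply: emeasurable_funM; apply/measurable_EFinP.
    apply: measurableT_comp => //.
    by apply: measurable_funD => //; exact: measurable_funM.
  apply: measurableT_comp; first exact: measurable_normal_pdf.
  by apply: measurable_funD => //; exact: measurable_funM.
- by move=> x _; rewrite mule_ge0// lee_fin ?normal_pdf_ge0.
- by rewrite lee_fin ltW.
apply: eq_integral => x _; rewrite addr0 muleCA -EFinM normal_pdf_scale//.
rewrite EFinM; congr (_%:E * _)%E; rewrite !indicE !mem_setE !in_itv/= !andbT.
by rewrite mulrC ler_pM2l.
Qed.

(** Completing the square: exponential tilting only shifts the mean by [a * s ^+ 2], up to a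
    constant. That constant is the moment generating function, since the shifted density has mass
    one. *)
Lemma expR_mul_normal_pdf s a x : s != 0 ->
  expR (a * x) * normal_pdf 0 s x =
  expR (a ^+ 2 * s ^+ 2 / 2) * normal_pdf (a * s ^+ 2) s x.
Proof.
move=> s0; rewrite !normal_pdfE//= ![normal_peak _ * _]mulrC !mulrA.
congr (_ * _); rewrite -!expRD; congr expR.
by field.
Qed.

Lemma normal_mgf s a : s != 0 ->
  (\int[normal_prob 0 s]_x (expR (a * x))%:E =
   (expR (a ^+ 2 * s ^+ 2 / 2))%:E)%E.
Proof.
move=> s0; rewrite ge0_integral_normal_prob//; last first.
  apply/measurable_EFinP/measurableT_comp => //; exact: measurable_funM.
under eq_integral do rewrite -EFinM expR_mul_normal_pdf// EFinM.
rewrite ge0_integralZl//; last 2 first.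
- by apply/measurable_EFinP; exact: measurable_normal_pdf.
- by move=> x _; rewrite lee_fin normal_pdf_ge0.
by rewrite integral_normal_pdf mule1.
Qed.

(* Completing the square in [x]: the second factor on the right is a density
   in [x], so integrating [x] out leaves the density of the sum. *)
Lemma normal_pdf_mul a b x z : 0 < a -> 0 < b ->
  let c := Num.sqrt (a ^+ 2 + b ^+ 2) in
  normal_pdf 0 a x * normal_pdf 0 b (z - x) =
  normal_pdf 0 c z * normal_pdf (z * a ^+ 2 / c ^+ 2) (a * b / c) x.
Proof.
move=> a0 b0 c.
have cE : c ^+ 2 = a ^+ 2 + b ^+ 2.
  by rewrite sqr_sqrtr// addr_ge0 ?sqr_ge0.
have c0 : 0 < c by rewrite sqrtr_gt0 addr_gt0// exprn_gt0.
have d0 : 0 < a * b / c by rewrite divr_gt0// mulr_gt0.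
rewrite !normal_pdfE ?gt_eqF//= !normal_peakE//.
rewrite mulrACA [RHS]mulrACA -!expRD; congr (_ * expR _).
  by field; rewrite !gt_eqF// sqrtr_gt0 mulrn_wgt0// pi_gt0.
rewrite expr_div_n cE.
have : a ^+ 2 + b ^+ 2 != 0 by rewrite -cE expf_neq0// gt_eqF.
by move=> C0; field; rewrite C0 !gt_eqF.
Qed.

Lemma normal_prob_convolution a b A : 0 < a -> 0 < b -> measurable A ->
  ((normal_prob 0 a \x normal_prob 0 b) [set z | A (z.1 + z.2)%R] =
   normal_prob 0 (Num.sqrt (a ^+ 2 + b ^+ 2)) A)%E.
Proof.
move=> a0 b0 mA; set c := Num.sqrt _.
pose S := [set z : measurableTypeR R * measurableTypeR R | A (z.1 + z.2)].
have mS : measurable S.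
  rewrite -[S]setTI; apply: (_ : measurable_fun setT
    (fun z : measurableTypeR R * measurableTypeR R => z.1 + z.2)) => //.
  exact: measurable_funD.
have mpdf m s : measurable_fun [set: R] (fun x => (normal_pdf m s x)%:E).
  by apply/measurable_EFinP; exact: measurable_normal_pdf.
have m1 : measurable_fun [set: R] (fun z => (\1_A z : R)%:E).
  by apply/measurable_EFinP; exact: measurable_indic.
have innerE x : normal_prob 0 b (xsection S x) =
    (\int[mu]_z ((\1_A z)%:E * (normal_pdf 0 b (z - x))%:E))%E.
  rewrite normal_probE; last exact: measurable_xsection.
  (* The second coordinate [y] is replaced by the sum [z = x + y], so the section of [S] becomes [A]
     itself, whatever [x] is. *)
  rewrite (@ge0_integral_lebesgue_affine _ 1 (- x))//; last 2 first.
  - apply: emeasurable_funM => //; apply/measurable_EFinP.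
    by apply: measurable_indic; exact: measurable_xsection.
  - by move=> y; rewrite mule_ge0// lee_fin normal_pdf_ge0.
  rewrite mul1e; apply: eq_integral => z _; rewrite mul1r; congr (_%:E * _)%E.
  rewrite !indicE mem_xsection /S; congr (nat_of_bool _)%:R.
  by apply/idP/idP; rewrite !inE/= addrC subrK.
rewrite /product_measure1 [LHS]ge0_integral_normal_prob//; last first.
  exact: measurable_fun_xsection.
pose F (z : measurableTypeR R * measurableTypeR R) : \bar R :=
  ((\1_A z.2)%:E * (normal_pdf 0 b (z.2 - z.1))%:E * (normal_pdf 0 a z.1)%:E)%E.
have mF : measurable_fun setT F.
  apply: emeasurable_funM; last first.
    exact: (measurableT_comp (mpdf 0 a) measurable_fst).
  apply: emeasurable_funM; first exact: (measurableT_comp m1 measurable_snd).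
  by apply: (measurableT_comp (mpdf 0 b)); exact: measurable_funB.
have F0 z : (0 <= F z)%E by rewrite !mule_ge0// lee_fin normal_pdf_ge0.
transitivity (\int[mu]_x \int[mu]_z F (x, z))%E.
  apply: eq_integral => x _ /=; rewrite innerE -ge0_integralZr//=.
  - apply: emeasurable_funM => //.
    by apply: (measurableT_comp (mpdf 0 b)); exact: measurable_funB.
  - by move=> y _; rewrite mule_ge0// lee_fin normal_pdf_ge0.
  - by rewrite lee_fin normal_pdf_ge0.
(* Exchanging the integrals puts [x] innermost, where [normal_pdf_mul] applies with [z] fixed. *)
rewrite (fubini_tonelli F mF F0) normal_probE//.
apply: eq_integral => z _ /=.
transitivity (\int[mu]_x ((\1_A z * normal_pdf 0 c z)%:E *
    (normal_pdf (z * a ^+ 2 / c ^+ 2) (a * b / c) x)%:E))%E.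
  apply: eq_integral => x _; rewrite /F -!EFinM; congr EFin.
  rewrite -[LHS]mulrA -[RHS]mulrA; congr (_ * _).
  by rewrite [LHS]mulrC; exact: normal_pdf_mul.
rewrite EFinM ge0_integralZl//.
- by rewrite integral_normal_pdf mule1.
- exact: mpdf.
- by move=> x _; rewrite lee_fin normal_pdf_ge0.
- by rewrite mule_ge0// lee_fin normal_pdf_ge0.
Qed.

End normal.

(* [X] is [N(0, s^2)] under the conditional probability given [E], multiplied
   out so that no division by [P E] occurs. *)
Definition normal_on d (T : measurableType d) (R : realType)
    (P : probability T R) (E : set T) (X : T -> R) (s : R) : Prop :=
  forall B : set R, measurable B ->
    P (X @^-1` B `&` E) = (normal_prob 0 s B * P E)%E.
Arguments normal_on {d T R}.

(** * Sums and exponential moments of conditionally Gaussian variables *)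

Section normal_on.
Context {d} {T : measurableType d} {R : realType} {P : probability T R}.
Implicit Types (E : set T) (X Y W : T -> R).

(** The first [normal_on] hypothesis encodes independence of [X] and [Y] given [E]. On rectangles
    the joint law of [(X, Y)] restricted to [E], divided by [P E], is the product of the two
    Gaussians; uniqueness of the product measure and convolution finish. *)
Lemma normal_on_add E X Y a b : 0 < a -> 0 < b -> measurable E ->
  measurable_fun setT X -> measurable_fun setT Y ->
  (forall B, measurable B -> normal_on P (Y @^-1` B `&` E) X a) ->
  normal_on P E Y b ->
  normal_on P E (fun w => X w + Y w) (Num.sqrt (a ^+ 2 + b ^+ 2)).
Proof.
move=> a0 b0 mE mX mY XE YE A mA.
have [k kE] : exists k : {nonneg R}, P E = k%:num%:E.
  exists (NngNum (fine_ge0 (measure_ge0 P E))).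
  by rewrite /= fineK// fin_num_measure.
(* A null [E] is treated apart because the joint law is normalised by [P E]. *)
have [k0|k0] := eqVneq k%:num 0.
  have PE0 : P E = 0%E by rewrite kE k0.
  apply/eqP; rewrite PE0 mule0 -measure_le0 -[leRHS]PE0.
  apply: le_measure; rewrite ?inE//.
  apply: measurableI => //; rewrite -[X in measurable X]setTI.
  by apply: measurable_funD.
have mXY : measurable_fun setT
    ((fun w => (X w, Y w)) : T -> measurableTypeR R * measurableTypeR R).
  by apply: measurable_fun_pair; [exact: mX|exact: mY].
have k0' : 0 <= k%:num^-1 by rewrite invr_ge0.
have mS : measurable [set z : measurableTypeR R * measurableTypeR R |
    A (z.1 + z.2)].
  rewrite -[X in measurable X]setTI.
  apply: (_ : measurable_fun setT
    (fun z : measurableTypeR R * measurableTypeR R => z.1 + z.2)) => //.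
  exact: measurable_funD.
rewrite -normal_prob_convolution//.
rewrite (product_measure_unique (m' := mscale (NngNum k0') (pushforward
  (mrestr P mE) ((fun w => (X w, Y w)) :
    T -> measurableTypeR R * measurableTypeR R))))//.
  rewrite /= /mscale /= /pushforward /mrestr kE.
  by rewrite muleAC -EFinM mulVf// mul1e.
move=> B C mB mC; rewrite /= /mscale /= /pushforward /mrestr.
have -> : (fun w => (X w, Y w)) @^-1` (B `*` C) `&` E =
  X @^-1` B `&` (Y @^-1` C `&` E) by rewrite setIA.
rewrite XE// YE// kE (muleA (normal_prob 0 a B)) (muleC _ k%:num%:E) muleA.
by rewrite -EFinM mulVf// mul1e.
Qed.

Lemma integral_expR_normal_on E W s a : s != 0 -> measurable E ->
  measurable_fun setT W -> normal_on P E W s ->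
  (\int[P]_(w in E) (expR (a * W w))%:E =
   P E * (expR (a ^+ 2 * s ^+ 2 / 2))%:E)%E.
Proof.
move=> s0 mE mW WE.
have [k kE] : exists k : {nonneg R}, P E = k%:num%:E.
  exists (NngNum (fine_ge0 (measure_ge0 P E))).
  by rewrite /= fineK// fin_num_measure.
have mf : measurable_fun setT (fun w => (expR (a * W w))%:E).
  by apply/measurable_EFinP/measurableT_comp => //; exact: measurable_funM.
have mg : measurable_fun [set: R] (fun x => (expR (a * x))%:E).
  by apply/measurable_EFinP/measurableT_comp => //; exact: measurable_funM.
rewrite (eq_measure_integral (mrestr P mE)); last first.
  by move=> A mA AE; rewrite /= /mrestr (setIidl AE).
transitivity (\int[mrestr P mE]_w (expR (a * W w))%:E)%E.
  (* The restricted measure does not charge the complement of [E], so integrating over [E] or over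
     the whole space is the same. *)
  rewrite [RHS](ge0_negligible_integral (measurableC mE))//.
    by rewrite setTD setCK; reflexivity.
  by rewrite /= /mrestr setICl measure0.
transitivity (\int[pushforward (mrestr P mE) (W : T -> measurableTypeR R)]_x
   (expR (a * x))%:E)%E.
  by rewrite ge0_integral_pushforward.
rewrite (eq_measure_integral (mscale k (normal_prob 0 s))).
  by rewrite ge0_integral_mscale// normal_mgf// kE.
by move=> A mA _; rewrite /= /mscale /= /pushforward /mrestr WE// kE muleC.
Qed.

End normal_on.

(** * Signed sums of independent Gaussians *)

Section signed_sums.
Context {d} {T : measurableType d} {R : realType} {P : probability T R}.

Lemma normal_on_sign E (X : {RV P >-> R}) s (e : bool) : s != 0 ->
  normal_on P E X s ->
  normal_on P E (fun w => (-1) ^+ e * X w) s.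
Proof.
move=> s0 XE B mB; case: e; last first.
  rewrite -XE//; congr (P (_ `&` _)).
  by apply/funext => w/=; rewrite expr0 mul1r.
rewrite -normal_prob_opp// -XE//.
  by congr (P (_ `&` _)); apply/funext => w/=; rewrite expr1 mulN1r.
by rewrite -[X in measurable X]setTI; exact: oppr_measurable.
Qed.

Context {I : eqType} {X : I -> {RV P >-> R}} {s : I -> R} (e : I -> bool).
Context (indep : mutually_independent P (fun i => X i : T -> R)).
Context (s_gt0 : forall i, 0 < s i).
Context (lawX : forall i, has_normal_law (X i) 0 (s i)).

Let event (J : seq I) (B : I -> set R) : set T :=
  \bigcap_(j in [set` J]) (X j @^-1` B j).

Lemma measurable_event J B :
  (forall i, measurable (B i)) -> measurable (event J B).
Proof.
move=> mB; apply: fin_bigcap_measurable => // j _.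
by rewrite -[X in measurable X]setTI; exact: measurable_funPT.
Qed.

(** As [B] is defined on all indices, one more constraint amounts to overriding [B] at [j], which
    leaves the others alone because [j] is not in [J]. *)
Lemma event_cons j J B C : j \notin J ->
  X j @^-1` C `&` event J B =
  event (j :: J) (fun i => if i == j then C else B i).
Proof.
move=> jJ; apply/seteqP; split => w /=.
  move=> [Cw Jw] i /=; rewrite inE => /orP[/eqP->|iJ]; first by rewrite eqxx.
  by case: eqP => [ij|_]; [rewrite -ij iJ in jJ|exact: Jw].
move=> Jw; split; first by have := Jw j; rewrite /= eqxx mem_head; apply.
move=> i /= iJ; have := Jw i; rewrite /= inE iJ orbT.
by case: eqP => [ij|_]; [rewrite -ij iJ in jJ|apply].
Qed.

Lemma normal_on_event x J B : uniq (x :: J) -> (forall i, measurable (B i)) ->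
  normal_on P (event J B) (X x) (s x).
Proof.
move=> uxJ mB C mC; have /andP[xJ uJ] := uxJ.
rewrite event_cons// indep//; last by move=> i; case: ifP.
rewrite big_cons eqxx indep// -(lawX x _ mC); congr (_ * _)%E.
by apply: eq_big_seq => i iJ; case: eqP => // ix; rewrite -ix iJ in xJ.
Qed.

Lemma prob_event_cons x J B C : uniq (x :: J) ->
  (forall i, measurable (B i)) -> measurable C ->
  P (event (x :: J) (fun i => if i == x then C else B i)) =
  (normal_prob 0 (s x) C * P (event J B))%E.
Proof.
move=> uxJ mB mC; have /andP[xJ _] := uxJ.
by rewrite -(event_cons x J B C xJ); exact: normal_on_event.
Qed.

Lemma measurable_signed_sum K :
  measurable_fun setT (fun w => \sum_(i <- K) (-1) ^+ e i * X i w).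
Proof.
apply: measurable_sum => i; exact: measurable_funM.
Qed.

(** Induction on the list, adding one variable to the sum of the rest. Keeping [J] general is what
    yields independence: the constraint on [X x] is absorbed into the event, and the induction
    hypothesis for [x :: J] splits off the remaining sum. A nonempty list keeps the standard
    deviation positive. *)
Lemma normal_on_sum x K J B : uniq (x :: K ++ J) ->
  (forall i, measurable (B i)) ->
  normal_on P (event J B)
    (fun w => \sum_(i <- x :: K) (-1) ^+ e i * X i w)
    (Num.sqrt (\sum_(i <- x :: K) s i ^+ 2)).
Proof.
elim: K x J B => [|y K IH] x J B uxKJ mB.
  rewrite big_seq1 sqrtr_sqr gtr0_norm//.
  under eq_fun do rewrite big_seq1.
  by apply: normal_on_sign; rewrite ?gt_eqF//; exact: normal_on_event.
have /= /and3P[] := uxKJ; rewrite inE mem_cat !negb_or.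
move=> /andP[xy /andP[xK xJ]] yKJ uKJ.
have uJ : uniq J by move: uKJ; rewrite cat_uniq => /and3P[].
have sum_gt0 : 0 < \sum_(i <- y :: K) s i ^+ 2.
  rewrite big_cons ltr_pwDl ?exprn_gt0//.
  by apply: sumr_ge0 => i _; exact: sqr_ge0.
(* The variance of the tail is written as the square of its standard deviation, the form produced by
   [normal_on_add]. *)
rewrite big_cons -(sqr_sqrtr (ltW sum_gt0)).
under eq_fun do rewrite big_cons.
apply: normal_on_add.
- exact: s_gt0.
- by rewrite sqrtr_gt0.
- exact: measurable_event.
- exact: measurable_funM.
- exact: measurable_signed_sum.
- move=> C mC; apply: normal_on_sign; first by rewrite gt_eqF.
  move=> D mD; rewrite setICA event_cons//.
  rewrite IH//; last by move=> i; case: ifP.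
    rewrite IH//; last by rewrite /= yKJ.
    have uxJ : uniq (x :: J) by rewrite /= xJ.
    by rewrite (prob_event_cons x J B D uxJ mB mD); exact: muleCA.
  exact: (etrans (uniq_catCA (y :: K) [:: x] J)).
- by apply: IH => //=; rewrite yKJ.
Qed.

(** The constraint on [X y] joins the event on [J]; [normal_on_sum] then factors out the sum over
    [x :: K] with and without it, leaving the Gaussian factor of [X y]. *)
Lemma normal_on_past x K y J A B : uniq (x :: K ++ y :: J) ->
  measurable A -> (forall i, measurable (B i)) ->
  normal_on P
    (event J B `&` (fun w => \sum_(i <- x :: K) (-1) ^+ e i * X i w) @^-1` A)
    (X y) (s y).
Proof.
move=> uKyJ mA mB C mC.
have uyJ : uniq (y :: J).
  by move: uKyJ => /= /andP[_]; rewrite cat_uniq => /and3P[].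
have uKJ : uniq (x :: K ++ J).
  by move: uKyJ; rewrite -cat_cons (uniq_catCA _ [:: y] J) => /= /andP[].
have /= /andP[yJ _] := uyJ.
rewrite setIA event_cons// setIC normal_on_sum//; last by move=> i; case: ifP.
rewrite (prob_event_cons y J B C uyJ mB mC) (setIC (event J B)).
by rewrite (normal_on_sum x K J B uKJ mB A mA); exact: muleCA.
Qed.

End signed_sums.

(** * Linear calculus of integrals with integrability *)

(** Integrability travels with the value because additivity for signed functions requires it. *)
Definition has_integral d (T : measurableType d) (R : realType)
    (mu : {measure set T -> \bar R}) (D : set T) (f : T -> R) (v : R) : Prop :=
  mu.-integrable D (EFin \o f) /\ (\int[mu]_(x in D) (f x)%:E = v%:E)%E.
Arguments has_integral {d T R}.

Section has_integral.
Context {d} {T : measurableType d} {R : realType}.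
Context {mu : {measure set T -> \bar R}} {D : set T}.
Context (mD : measurable D).
Implicit Types (f g : T -> R) (u v c : R).

Lemma has_integralD f g u v : has_integral mu D f u -> has_integral mu D g v ->
  has_integral mu D (fun x => f x + g x) (u + v).
Proof.
move=> [if_ fu] [ig gv]; split; first exact: (integrableD mD if_ ig).
under eq_integral do rewrite EFinD.
by rewrite (integralD_EFin mD if_ ig) EFinD -fu -gv.
Qed.

Lemma has_integralB f g u v : has_integral mu D f u -> has_integral mu D g v ->
  has_integral mu D (fun x => f x - g x) (u - v).
Proof.
move=> [if_ fu] [ig gv]; split; first exact: (integrableB mD if_ ig).
under eq_integral do rewrite EFinB.
by rewrite (integralB_EFin mD if_ ig) EFinB -fu -gv.
Qed.

Lemma has_integralZ f u c : has_integral mu D f u ->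
  has_integral mu D (fun x => c * f x) (c * u).
Proof.
move=> [if_ fu]; split; first exact: (integrableZl mD c if_).
under eq_integral do rewrite EFinM.
by rewrite (integralZl mD if_) EFinM -fu.
Qed.

Lemma has_integral_indic f u : has_integral mu D f u ->
  has_integral mu setT (fun x => \1_D x * f x) u.
Proof.
have fE : (EFin \o f) \_ D = EFin \o (fun x => \1_D x * f x).
  by rewrite epatch_indic; apply/funext => x /=; rewrite mulrC EFinM.
move=> [/(integrable_mkcond _ mD)]; rewrite fE => if_ fu; split => //.
rewrite -fu [RHS]integral_mkcond; apply: eq_integral => x _.
by rewrite -[RHS]/(((EFin \o f) \_ D) x) fE.
Qed.

End has_integral.

(** * Moments of the gross return difference on a trading event *)

Section moments.
Context {d} {T : measurableType d} {R : realType} {P : probability T R}.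
Implicit Types (E : set T) (W D : T -> R).

Lemma has_integral_expR E W s p a b : s != 0 -> measurable E ->
  measurable_fun setT W -> normal_on P E W s -> P E = p%:E ->
  has_integral P E (fun w => expR (b + a * W w))
    (p * expR (b + a ^+ 2 * s ^+ 2 / 2)).
Proof.
move=> s0 mE mW WE Ep.
have -> : (fun w => expR (b + a * W w)) = (fun w => expR b * expR (a * W w)).
  by apply/funext => w; rewrite expRD.
rewrite expRD mulrCA; apply: has_integralZ => //.
have h := integral_expR_normal_on E W s a s0 mE mW WE.
split; last by rewrite h Ep EFinM.
apply/integrableP; split.
  apply/measurable_EFinP; apply: measurable_funTS.
  by apply: measurableT_comp => //; exact: measurable_funM.
(* The integrand is positive, so its finite integral already gives integrability. *)
under eq_integral do rewrite /= ger0_norm ?expR_ge0//.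
by rewrite h Ep -EFinM ltry.
Qed.

Context {D1 D2 : T -> R} (mu1 mu2 : R) {s1 s2 : R}.
Context (s1_gt0 : 0 < s1) (s2_gt0 : 0 < s2).
Context (mD1 : measurable_fun setT D1) (mD2 : measurable_fun setT D2).

Let spread w := expR (mu2 + D2 w) - expR (mu1 + D1 w).

Lemma has_integral_spread E p : measurable E -> P E = p%:E ->
  normal_on P E D1 s1 -> normal_on P E D2 s2 ->
  has_integral P setT (fun w => \1_E w * spread w)
    (p * expR (mu2 + s2 ^+ 2 / 2) - p * expR (mu1 + s1 ^+ 2 / 2)).
Proof.
move=> mE Ep N1 N2; apply: has_integral_indic => //.
have h D m s : 0 < s -> measurable_fun setT D -> normal_on P E D s ->
    has_integral P E (fun w => expR (m + D w)) (p * expR (m + s ^+ 2 / 2)).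
  move=> s0 mD ND.
  have := has_integral_expR E D s p 1 m (lt0r_neq0 s0) mE mD ND Ep.
  by rewrite expr1n mul1r; under eq_fun do rewrite mul1r.
by apply: has_integralB => //; exact: h.
Qed.

(** In the expanded square every term is an exponential of a Gaussian: the squares have exponent
    coefficient 2, and the cross term is the exponential of [D1 + D2], whence the hypothesis on the
    law of that sum. *)
Lemma has_integral_spread2 E p : measurable E -> P E = p%:E ->
  normal_on P E D1 s1 -> normal_on P E D2 s2 ->
  normal_on P E (fun w => D1 w + D2 w) (Num.sqrt (s1 ^+ 2 + s2 ^+ 2)) ->
  has_integral P setT (fun w => \1_E w * spread w ^+ 2)
    (p * expR (2 * mu1 + 2 * s1 ^+ 2) + p * expR (2 * mu2 + 2 * s2 ^+ 2)
     - 2 * (p * expR (mu1 + mu2 + s1 ^+ 2 / 2 + s2 ^+ 2 / 2))).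
Proof.
move=> mE Ep N1 N2 N12; apply: has_integral_indic => //.
have h D m s : 0 < s -> measurable_fun setT D -> normal_on P E D s ->
    has_integral P E (fun w => expR (2 * m + 2 * D w))
      (p * expR (2 * m + 2 * s ^+ 2)).
  move=> s0 mD ND.
  have := has_integral_expR E D s p 2 (2 * m) (lt0r_neq0 s0) mE mD ND Ep.
  by rewrite (_ : 2 ^+ 2 * s ^+ 2 / 2 = 2 * s ^+ 2)//; field.
have sE : Num.sqrt (s1 ^+ 2 + s2 ^+ 2) ^+ 2 = s1 ^+ 2 + s2 ^+ 2.
  by rewrite sqr_sqrtr// addr_ge0 ?sqr_ge0.
have s_neq0 : Num.sqrt (s1 ^+ 2 + s2 ^+ 2) != 0.
  by rewrite gt_eqF// sqrtr_gt0 addr_gt0// exprn_gt0.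
have mD12 : measurable_fun setT (fun w => D1 w + D2 w).
  exact: measurable_funD.
have h12 := has_integral_expR E _ _ p 1 (mu1 + mu2) s_neq0 mE mD12 N12 Ep.
rewrite sE expr1n mul1r mulrDl addrA in h12.
have -> : (fun w => spread w ^+ 2) = (fun w =>
    expR (2 * mu1 + 2 * D1 w) + expR (2 * mu2 + 2 * D2 w)
    - 2 * expR (mu1 + mu2 + 1 * (D1 w + D2 w))).
  apply/funext => w; rewrite /spread -!mulrDr !mul1r.
  rewrite (_ : mu1 + mu2 + (D1 w + D2 w) = (mu1 + D1 w) + (mu2 + D2 w)).
    rewrite (expRD (mu1 + D1 w) (mu2 + D2 w)) !expRM_natl; ring.
  by rewrite addrACA.
apply: has_integralB => //; last exact: has_integralZ.
by apply: has_integralD => //; exact: h.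
Qed.

End moments.

(* The pair [(b, m)] stands for the increment at time [m + 1] of stock 2 if [b]
   holds and of stock 1 otherwise. *)
Fixpoint past (n : nat) : seq (bool * nat) :=
  if n is m.+1 then [:: (false, m), (true, m) & past m] else [::].

Lemma past_lt n i : i \in past n -> (i.2 < n)%N.
Proof.
elim: n => //= n IH; rewrite !inE => /or3P[/eqP->//|/eqP->//|/IH].
exact: ltnW.
Qed.

(** Time stamps separate past from future indices; this supplies the distinctness that independence
    asks for. *)
Lemma uniq_past_cat n J : uniq J -> all (fun i => n <= i.2)%N J ->
  uniq (past n ++ J).
Proof.
move=> uJ nJ; rewrite cat_uniq uJ andbT; apply/andP; split; last first.
  by apply/hasPn => i /(allP nJ); rewrite leqNgt; apply/contra/past_lt.
elim: n {nJ} => //= n ->; rewrite andbT inE /=.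
by apply/andP; split; apply/negP => /past_lt; rewrite ltnn.
Qed.

(** * Mean and variance of the pair return *)

Theorem theorem3 (d : measure_display) (T : measurableType d) (R : realType)
  (P : probability T R)
  (mu1 mu2 sigma1 sigma2 k : R)
  (delta1 delta2 : nat -> {RV P >-> R})
  (p1 p2 : nat -> T -> R) :
  0 < sigma1 -> 0 < sigma2 -> 0 < k ->
  (* delta_{i,t}, i = 1,2, t >= 1, are mutually independent *)
  mutually_independent P
    (fun it : bool * nat => if it.1 then (delta2 it.2.+1 : T -> R)
                            else (delta1 it.2.+1 : T -> R)) ->
  (forall t, (1 <= t)%N -> has_normal_law (delta1 t) 0 sigma1) ->
  (forall t, (1 <= t)%N -> has_normal_law (delta2 t) 0 sigma2) ->
  (forall t w, 0 < p1 t w) -> (forall t w, 0 < p2 t w) ->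
  (* deterministic, equal initial log-prices *)
  (exists c : R, forall w, ln (p1 0%N w) = c /\ ln (p2 0%N w) = c) ->
  (forall t w, ln (p1 t.+1 w) = ln (p1 t w) + mu1 + delta1 t.+1 w) ->
  (forall t w, ln (p2 t.+1 w) = ln (p2 t w) + mu2 + delta2 t.+1 w) ->
  let eps t w := ln (p2 t w) - ln (p1 t w) - (mu2 - mu1) * t%:R in
  let s t := Num.sqrt (t%:R * (sigma1 ^+ 2 + sigma2 ^+ 2)) in
  let S t w := (if eps t w <= - k * s t then 1 else 0) -
                (if eps t w >= k * s t then 1 else 0) in
  let r1 t w := p1 t.+1 w / p1 t w - 1 in
  let r2 t w := p2 t.+1 w / p2 t w - 1 in
  let r t w := S t w * (r2 t w - r1 t w) in
  forall t, (1 <= t)%N ->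
    ('E_P[r t] = 0)%E /\
    ('V_P[r t] =
      2%:E * normal_prob 0 1 `[k, +oo[ *
       (expR (2 * mu1 + 2 * sigma1 ^+ 2) + expR (2 * mu2 + 2 * sigma2 ^+ 2)
        - 2 * expR (mu1 + mu2 + sigma1 ^+ 2 / 2 + sigma2 ^+ 2 / 2))%R%:E)%E.
Proof.
move=> s1_gt0 s2_gt0 k_gt0 ind law1 law2 p1_gt0 p2_gt0 [c p0] H1 H2.
move=> eps s S r1 r2 r [//|t] _.
pose X (i : bool * nat) : {RV P >-> R} :=
  if i.1 then delta2 i.2.+1 else delta1 i.2.+1.
pose sg (i : bool * nat) := if i.1 then sigma2 else sigma1.
(* Increments of stock 1 enter the spread with a minus sign. *)
pose e (i : bool * nat) := ~~ i.1.
have sg_gt0 i : 0 < sg i by rewrite /sg; case: ifP.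
have lawX i : has_normal_law (X i) 0 (sg i).
  by case: i => -[] n; [exact: law2|exact: law1].
have indX : mutually_independent P (fun i => X i : T -> R).
  rewrite (_ : (fun i => X i : T -> R) = (fun it : bool * nat =>
    if it.1 then (delta2 it.2.+1 : T -> R) else (delta1 it.2.+1 : T -> R)))//.
  by apply/funext => -[[] n].
(* The equal initial log-prices cancel, and the drifts are removed by the term [(mu2 - mu1) * t]. *)
have epsE n : eps n = (fun w => \sum_(i <- past n) (-1) ^+ e i * X i w).
  apply/funext => w; elim: n => [|n IH].
    by rewrite big_nil /eps; have [-> ->] := p0 w; rewrite mulr0 !subrr.
  rewrite !big_cons /= -IH /eps H1 H2 -natr1 /X /=; ring.
have sumE n : \sum_(i <- past n) sg i ^+ 2 =
    n%:R * (sigma1 ^+ 2 + sigma2 ^+ 2).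
  elim: n => [|n IH]; first by rewrite big_nil mul0r.
  by rewrite !big_cons /= IH -natr1 /sg /=; ring.
set N := t.+1.
have mpre A : measurable A -> measurable (eps N @^-1` A).
  move=> mA; rewrite -[X in measurable X]setTI epsE.
  exact: measurable_signed_sum.
have epsN A : measurable A -> P (eps N @^-1` A) = normal_prob 0 (s N) A.
  move=> mA; rewrite /s epsE -sumE.
  have := normal_on_sum e indX sg_gt0 lawX (false, t)
    ((true, t) :: past t) [::] (fun=> setT)
    (uniq_past_cat N [::] isT isT) (fun=> measurableT) A mA.
  by rewrite set_nil bigcap_set0 setIT probability_setT mule1.
(* An index with second component at least [N] is an increment at time [N + 1] or later, hence
   outside [past N]. *)
have onJ y J C A : uniq (y :: J) -> all (fun i => N <= i.2)%N (y :: J) ->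
    measurable C -> measurable A ->
    normal_on P (\bigcap_(j in [set` J]) X j @^-1` C `&` eps N @^-1` A)
      (X y) (sg y).
  move=> uJ nJ mC mA; rewrite epsE.
  exact: (normal_on_past e indX sg_gt0 lawX (false, t)
    ((true, t) :: past t) y J A (fun=> C) (uniq_past_cat N _ uJ nJ)).
have on1 y A : (N <= y.2)%N -> measurable A ->
    normal_on P (eps N @^-1` A) (X y) (sg y).
  move=> Ny mA; have := onJ y [::] setT A isT.
  by rewrite set_nil bigcap_set0 setTI; apply => //=; rewrite Ny.
have on2 A : measurable A -> normal_on P (eps N @^-1` A)
    (fun w => delta1 N.+1 w + delta2 N.+1 w)
    (Num.sqrt (sigma1 ^+ 2 + sigma2 ^+ 2)).
  move=> mA; apply: normal_on_add => //; first exact: mpre.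
    (* Adding the increment of stock 2 at the same time to the event shows that the two increments
       are independent given the past. *)
    move=> C mC; have := onJ (false, N) [:: (true, N)] C A isT.
    by rewrite set_cons1 bigcap_set1; apply => //=; rewrite leqnn.
  exact: (on1 (true, N)).
have sN_gt0 : 0 < s N.
  by rewrite sqrtr_gt0 mulr_gt0// addr_gt0// exprn_gt0.
pose EL := eps N @^-1` `]-oo, - k * s N].
pose EG := eps N @^-1` `[k * s N, +oo[.
pose q := fine (normal_prob 0 1 `[k, +oo[).
have qE : normal_prob 0 1 `[k, +oo[ = q%:E.
  by rewrite fineK//; apply: (fin_num_measure (normal_prob 0 1)).
have PEG : P EG = q%:E by rewrite (epsN _ (measurable_itv _)) normal_prob_tail.
have PEL : P EL = q%:E.
  rewrite (epsN _ (measurable_itv _)) -qE -(normal_prob_tail (s N))//.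
  (* Reflection carries the upper tail to the lower one, so both trading events have probability
     [q]. *)
  rewrite -[RHS](normal_prob_opp _ _ (lt0r_neq0 sN_gt0) (measurable_itv _)).
  by rewrite opp_preimage_itvbndy mulNr.
pose D w := expR (mu2 + delta2 N.+1 w) - expR (mu1 + delta1 N.+1 w).
have ratio (p p' m x : R) : 0 < p -> 0 < p' -> ln p' = ln p + m + x ->
    p' / p = expR (m + x).
  move=> p_gt0 p'_gt0 h; apply: (canLR (mulfK _)); first by rewrite gt_eqF.
  by rewrite -[LHS]lnK// h -addrA (expRD (ln p)) (lnK p_gt0) mulrC.
have ELE w : \1_EL w = (eps N w <= - k * s N)%R%:R :> R.
  rewrite indicE; congr (nat_of_bool _)%:R.
  by apply/idP/idP; rewrite !inE /EL /= in_itv.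
have EGE w : \1_EG w = (k * s N <= eps N w)%R%:R :> R.
  rewrite indicE; congr (nat_of_bool _)%:R.
  by apply/idP/idP; rewrite !inE /EG /= in_itv /= andbT.
have SE w : S N w = \1_EL w - \1_EG w.
  by rewrite /S ELE EGE; case: ifP; case: ifP.
have rE w : r N w = \1_EL w * D w - \1_EG w * D w.
  rewrite -mulrBl -SE /r /r1 /r2; congr (_ * _).
  rewrite (ratio (p1 N w) (p1 N.+1 w) mu1 (delta1 N.+1 w))//.
  by rewrite (ratio (p2 N w) (p2 N.+1 w) mu2 (delta2 N.+1 w))// /D; ring.
(* Both signals at once would force [k * s N <= - (k * s N)], impossible for a positive
   threshold. *)
have disj w : \1_EL w * \1_EG w = 0 :> R.
  rewrite ELE EGE -natrM mulnb; apply/eqP; rewrite pnatr_eq0 eqb0.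
  apply/negP => /andP[le1 le2]; have := mulr_gt0 k_gt0 sN_gt0.
  by move: (le_trans le2 le1); rewrite mulNr; lra.
have sq01 (E : set T) w : \1_E w * \1_E w = \1_E w :> R.
  by rewrite indicE; case: (_ \in _); rewrite ?mulr1 ?mulr0.
(* The event enters these two moments only through its probability [q], so they coincide for [EL]
   and [EG]. *)
have moments A : measurable A -> P (eps N @^-1` A) = q%:E ->
    has_integral P setT (fun w => \1_(eps N @^-1` A) w * D w)
      (q * expR (mu2 + sigma2 ^+ 2 / 2) - q * expR (mu1 + sigma1 ^+ 2 / 2)) /\
    has_integral P setT (fun w => \1_(eps N @^-1` A) w * D w ^+ 2)
      (q * expR (2 * mu1 + 2 * sigma1 ^+ 2) +
       q * expR (2 * mu2 + 2 * sigma2 ^+ 2) -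
       2 * (q * expR (mu1 + mu2 + sigma1 ^+ 2 / 2 + sigma2 ^+ 2 / 2))).
  move=> mA PA; have mE := mpre A mA.
  have mD1 : measurable_fun setT (delta1 N.+1) by [].
  have mD2 : measurable_fun setT (delta2 N.+1) by [].
  have n1 := on1 (false, N) A (leqnn N) mA.
  have n2 := on1 (true, N) A (leqnn N) mA.
  split; first exact: (has_integral_spread mu1 mu2 s1_gt0 s2_gt0
    mD1 mD2 _ _ mE PA n1 n2).
  exact: (has_integral_spread2 mu1 mu2 s1_gt0 s2_gt0
    mD1 mD2 _ _ mE PA n1 n2 (on2 A mA)).
have [L1 L2] := moments _ (measurable_itv _) PEL.
have [G1 G2] := moments _ (measurable_itv _) PEG.
have Er : ('E_P[r N] = 0)%E.
  have [_] := has_integralB measurableT _ _ _ _ L1 G1.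
  rewrite subrr => int0; rewrite unlock -[RHS]int0; apply: eq_integral => w _.
  by rewrite rE.
split=> //.
have [_] := has_integralD measurableT _ _ _ _ L2 G2.
move=> h; rewrite qE -!EFinM.
(* With zero mean the variance is the second moment; idempotent indicators and a vanishing cross
   term reduce [r N w ^+ 2] to this sum. *)
transitivity (\int[P]_w (\1_EL w * D w ^+ 2 + \1_EG w * D w ^+ 2)%:E)%E.
  rewrite /variance covariance.unlock Er/= unlock.
  apply: eq_integral => w _ /=; congr EFin.
  transitivity (r N w ^+ 2).
    by rewrite expr2 -[LHS]/((_ - 0) * (_ - 0)) subr0.
  rewrite rE; have := disj w; have := sq01 EG w; have := sq01 EL w.
  by move: (\1_EL w) (\1_EG w) (D w) => x y z xx yy xy; ring: xx yy xy.
by rewrite h; congr EFin; ring.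
Qed.
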